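(* Let $k \geq 2$ and $n$ be positive integers and let $T$ be a tree on $k$ vertices. Then there exist positive constants $c$, $\alpha^-$ and $\alpha^+$ which depend on $k$, such that $$\alpha^- n^k (b+1)^{1-k} \leq S(T,n,b) \leq \alpha^+ n^k (b+1)^{1-k}$$ for every positive integer $b$ with $b \leq c\cdot n^{k/(k-1)}$.
   Context: A biased $(b:1)$ Waiter-Client game $(X,\mathcal F)$ is played in rounds: in each round Waiter offers Client exactly $b+1$ previously unselected elements of the finite board $X$; Client keeps one and Waiter gets the other $b$; if at most $b$ free elements remain, they go to Waiter. The value is the number of winning sets $A\in\mathcal F$ fully claimed by Client at the end under optimal play (Waiter maximizes, Client minimizes). $S(H,n,b)$ is the value of the $(b:1)$ Waiter-Client game on the edge set of $K_n$ whose winning sets are the edge sets of all copies of the graph $H$ in $K_n$. *)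

(* Defs.v *)
From mathcomp Require Import all_boot.

Set Implicit Arguments.
Unset Strict Implicit.
Unset Printing Implicit Defensive.

Section WaiterClient.

Variables (X : finType) (Fam : {set {set X}}) (b : nat).

(* Value, by backward induction, of the position in which the elements of
   [free] are unselected and Client owns the elements of [C]. Each round
   removes b + 1 elements from [free], so a fuel of at least #|free| never
   runs out before the test #|free| <= b succeeds. The value is at most #|Fam|,
   which therefore is a neutral default for the (nonempty) minimum. *)
Fixpoint wc_value_from (fuel : nat) (free C : {set X}) : nat :=
  if fuel is fuel'.+1 then
    if #|free| <= b then #|[set A in Fam | A \subset C]|
    else \max_(offer : {set X} | (offer \subset free) && (#|offer| == b.+1))
           \big[minn/#|Fam|]_(x in offer)
             wc_value_from fuel' (free :\: offer) (x |: C)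
  else #|[set A in Fam | A \subset C]|.

Definition wc_value (board : {set X}) : nat := wc_value_from #|board| board set0.

End WaiterClient.

Definition complete_edges (n : nat) : {set {set 'I_n}} :=
  [set uv : {set 'I_n} | #|uv| == 2].

Definition copy_edges (V : finType) (e : rel V) (n : nat) (f : {ffun V -> 'I_n}) :
    {set {set 'I_n}} :=
  [set [set f xy.1; f xy.2] | xy in [set xy : V * V | e xy.1 xy.2]].

Definition copies (V : finType) (e : rel V) (n : nat) : {set {set {set 'I_n}}} :=
  [set copy_edges e f | f in [set f : {ffun V -> 'I_n} | injectiveb f]].

Definition S_value (V : finType) (e : rel V) (n b : nat) : nat :=
  wc_value (copies e n) b (complete_edges n).

Definition is_simple_graph (V : finType) (e : rel V) : Prop :=
  symmetric e /\ irreflexive e.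

(* A cycle [c] of a simple graph in the sense of [ucycle] may have size 0 or 2
   (an edge traversed back and forth); graph cycles are those of size > 2. *)
Definition is_tree (V : finType) (e : rel V) : Prop :=
  [/\ is_simple_graph e,
      0 < #|V|,
      forall x y : V, connect e x y
    & forall c : seq V, ucycle e c -> size c <= 2].

(* Main.v *)
(** Upper bound: let q = 1/(b+1) and weigh a winning set A that Waiter has not
    touched by q^|A \ C|, where C is what Client owns. If Client picked uniformly
    among the b+1 offered elements, the expected total weight would not increase,
    so some pick does not increase it. At the end the weight counts the winning
    sets inside C, and at the start it is at most n^k q^(k-1), because a copy of
    the tree has at least k-1 edges.

    Lower bound: split the vertices of K_n into k blocks of size m = n/k, one per
    vertex of the tree, and let Waiter build copies that respect the blocks,
    following an order of the vertices in which each vertex v but the first has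
    exactly one earlier neighbour p.
    If b+1 <= m, Waiter offers, from every vertex of the block of p, m/(b+1)
    disjoint stars into the block of v, and the number of copies is multiplied
    by m/(b+1).
    If b+1 > m, Waiter keeps the copies vertex-disjoint. In each round he offers
    edges from g ~ 2(b+1)/m copies to the unused vertices of the block of v; these
    copies are spent and one of them gets extended. The number of copies is
    divided by g at each of the k-1 stages, and the bound on b ensures that
    m / g^(k-1) is at least 1. *)
Require Import Defs.
From mathcomp Require Import all_boot all_order all_algebra.
From mathcomp Require Import reals exp.
From mathcomp Require Import zify.
Import Order.TTheory GRing.Theory Num.Theory.

Set Implicit Arguments.
Unset Strict Implicit.
Unset Printing Implicit Defensive.

(** * Forcing positions in the game *)

Lemma bigminn_le (I : finType) (A : {set I}) (M : nat) (F : I -> nat) (i : I) :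
  i \in A -> \big[minn/M]_(j in A) F j <= F i.
Proof.
move=> iA; have := mem_index_enum i.
elim: (index_enum I) => [//|j s IH]; rewrite big_cons inE => /orP[/eqP <-|/IH le].
  by rewrite iA geq_minl.
by case: ifP => // _; rewrite geq_min le orbT.
Qed.

Lemma leq_bigminn (I : finType) (A : {set I}) (N M : nat) (F : I -> nat) :
  N <= M -> (forall i, i \in A -> N <= F i) -> N <= \big[minn/M]_(j in A) F j.
Proof.
by move=> NM NF; elim/big_ind: _ => // v w Nv Nw; rewrite leq_min Nv.
Qed.

Lemma exists_subset_card (T : finType) (A : {set T}) (m : nat) :
  m <= #|A| -> exists2 B : {set T}, B \subset A & #|B| = m.
Proof.
case/card_geqP => s [us <- sA]; exists [set x in s].
  by apply/subsetP => x; rewrite inE => /sA.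
by rewrite cardsE; apply/card_uniqP.
Qed.

Section Forcing.

Variables (X : finType) (b : nat).
Implicit Types (F C O : {set X}) (P Q : {set X} -> {set X} -> Prop).

(** A strategy tree of Waiter: whatever Client keeps, a position satisfying [P] is reached after
    finitely many rounds. It may stop before the game ends. *)
Inductive forces P F C : Prop :=
| forces_done of P F C
| forces_offer O of O \subset F & #|O| = b.+1
    & forall x, x \in O -> forces P (F :\: O) (x |: C).

Lemma forces_trans P Q F C :
  (forall F' C', P F' C' -> forces Q F' C') -> forces P F C -> forces Q F C.
Proof.
move=> PQ; elim=> [F' C' /PQ//|F' C' O OF cO _ IH].
exact: forces_offer OF cO IH.
Qed.

Lemma forces_weaken P Q F C :
  (forall F' C', P F' C' -> Q F' C') -> forces P F C -> forces Q F C.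
Proof. by move=> PQ; apply: forces_trans => F' C' /PQ; apply: forces_done. Qed.

Lemma forces_reaches P F C : forces P F C -> exists F' C', P F' C'.
Proof.
elim=> [F' C' P0|F' C' O _ cO _ IH]; first by exists F', C'.
have [x /IH//] : exists x, x \in O by apply/card_gt0P; rewrite cO.
Qed.

Lemma forces_iter (P : nat -> {set X} -> {set X} -> Prop) (T : nat) F C :
  (forall t F' C', t < T -> P t F' C' ->
    exists O, [/\ O \subset F', #|O| = b.+1
      & forall x, x \in O -> P t.+1 (F' :\: O) (x |: C')]) ->
  P 0 F C -> forces (P T) F C.
Proof.
elim: T => [_|T IH step] P0; first exact: forces_done.
apply: forces_trans (IH _ P0) => [F' C' PT|t F' C' ltT]; last exact/step/leqW.
have [O [OF cO PO]] := step _ _ _ (leqnn _) PT.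
by apply: forces_offer OF cO _ => x /PO; apply: forces_done.
Qed.

(** The offers [O i] are fixed in advance and pairwise disjoint, so no choice of Client spoils a
    later offer. *)
Lemma forces_family (I : eqType) (O : I -> {set X}) (s : seq I) F C :
  uniq s -> {in s, forall i, O i \subset F} -> {in s, forall i, #|O i| = b.+1} ->
  {in s &, forall i j, i != j -> [disjoint O i & O j]} ->
  forces (fun F' C' => [/\ C \subset C',
      forall y, y \in F -> {in s, forall i, y \notin O i} -> y \in F'
    & {in s, forall i, exists2 x, x \in O i & x \in C'}]) F C.
Proof.
elim: s F C => [|i s IH] F C /=; first by move=> *; apply: forces_done; split.
case/andP=> is_ us OF cO dO.
apply: (@forces_offer _ _ _ (O i)); rewrite ?OF ?cO ?mem_head // => x xO.
have ins j : j \in s -> j \in i :: s by rewrite inE orbC => ->.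
have ij j : j \in s -> i != j by apply: contraTneq => <-.
apply: forces_weaken (IH (F :\: O i) (x |: C) us _ _ _).
- move=> F' C' [CC FF hit]; split=> [|y yF yO|j].
  + exact: subset_trans (subsetUr _ _) CC.
  + apply: FF => [|j js]; last exact/yO/ins.
    by rewrite inE yF yO ?mem_head.
  + rewrite inE => /orP[/eqP ->|]; last exact: hit.
    by exists x => //; apply: (subsetP CC); rewrite setU11.
- move=> j js; rewrite subsetD OF ?ins //= disjoint_sym.
  by apply: dO; rewrite ?mem_head ?ins ?ij.
- by move=> j /ins /cO.
- by move=> j l /ins js /ins ls; apply: dO.
Qed.

Variable Fam : {set {set X}}.

Lemma card_wins_le C : #|[set A in Fam | A \subset C]| <= #|Fam|.
Proof. by apply/subset_leq_card/subsetP => A; rewrite inE => /andP[]. Qed.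

Lemma leq_bigmax_offer (G : {set X} -> nat) F O :
  O \subset F -> #|O| = b.+1 ->
  G O <= \max_(B : {set X} | (B \subset F) && (#|B| == b.+1)) G B.
Proof.
by move=> OF cO; rewrite (bigop.bigD1 O) /= ?OF ?cO ?eqxx // leq_maxl.
Qed.

(** Client never loses an element, so further rounds cannot lower the count; this lets a strategy of
    Waiter stop early. *)
Lemma wc_value_from_ge_current fuel F C :
  #|[set A in Fam | A \subset C]| <= wc_value_from Fam b fuel F C.
Proof.
elim: fuel F C => [|fuel IH] F C //=; case: (leqP #|F| b) => // ltbF.
have [O OF cO] := exists_subset_card ltbF.
apply: leq_trans (leq_bigmax_offer _ OF cO).
apply: leq_bigminn => [|x _]; first exact: card_wins_le.
apply: (leq_trans _ (IH _ _)); apply/subset_leq_card/subsetP => A.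
rewrite !inE => /andP[-> sAC] /=; exact: subset_trans sAC (subsetUr _ _).
Qed.

Lemma forces_wc_value_from_ge N P fuel F C :
  #|F| <= fuel ->
  (forall F' C', P F' C' -> N <= #|[set A in Fam | A \subset C']|) ->
  forces P F C -> N <= wc_value_from Fam b fuel F C.
Proof.
move=> + PN H; elim: H fuel => {F C} [F C /PN le fuel _|F C O OF cO FO IH].
  exact: leq_trans le (wc_value_from_ge_current _ _ _).
have cOF : b.+1 <= #|F| by rewrite -cO; apply: subset_leq_card.
case=> [|fuel] leF /=; first by rewrite leqNgt (leq_trans _ cOF) in leF.
rewrite [#|F| <= b]leqNgt cOF /=.
have IHx x : x \in O -> N <= wc_value_from Fam b fuel (F :\: O) (x |: C).
  move=> xO; apply: IH => //; rewrite -ltnS (leq_trans _ leF) // cardsD.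
  rewrite (setIidPr OF) cO ltn_subrL /=; exact: leq_trans cOF.
apply: leq_trans (leq_bigmax_offer _ OF cO).
apply: leq_bigminn => //.
(* The default [#|Fam|] of the minimum must also be at least [N]; any position the strategy reaches
   shows this. *)
have [x /FO/forces_reaches[F' [C' /PN le]]] : exists x, x \in O.
  by apply/card_gt0P; rewrite cO.
exact/(leq_trans le)/card_wins_le.
Qed.

End Forcing.

(** * The potential of Client *)

Section Potential.

Local Open Scope ring_scope.
Variables (R : realFieldType) (X : finType) (Fam : {set {set X}}) (b : nat).
Implicit Types (F C O A : {set X}).

Definition potential F C : R :=
  \sum_(A in Fam | A \subset F :|: C) b.+1%:R^-1 ^+ #|A :\: C|.

(** If [A] meets [O] in [x0], only the choice of [x0] can keep [A] alive, and it multiplies the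
    weight by b + 1. If [A] misses [O], all b + 1 choices leave its weight unchanged. *)
Lemma potential_weight_offer F C O A :
  [disjoint F & C] -> O \subset F -> #|O| = b.+1 -> A \subset F :|: C ->
  \sum_(x in O) (if A \subset (F :\: O) :|: (x |: C)
                 then b.+1%:R^-1 ^+ #|A :\: (x |: C)| else 0)
    <= b.+1%:R * b.+1%:R^-1 ^+ #|A :\: C| :> R.
Proof.
move=> dFC OF cO AFC.
have q_ge0 : 0 <= b.+1%:R^-1 :> R by rewrite invr_ge0 ler0n.
have notC x : x \in O -> x \notin C.
  by move=> /(subsetP OF) xF; rewrite (disjointFr dFC xF).
have [/pred0Pn[x0 /andP[/= x0A x0O]]|dAO] := boolP (~~ [disjoint A & O]).
  rewrite (big_setD1 x0) //= big1 ?addr0 => [|x /setD1P[xx0 xO]].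
    have -> : #|A :\: C| = #|A :\: (x0 |: C)|.+1.
      rewrite (cardsD1 x0 (A :\: C)) inE notC // x0A add1n; congr _.+1.
      by apply: eq_card => y; rewrite !inE negb_or andbA.
    rewrite exprS mulrA divff ?pnatr_eq0 // mul1r.
    by case: ifP => // _; rewrite exprn_ge0.
  case: ifP => // /subsetP/(_ x0 x0A).
  by rewrite !inE x0O eq_sym (negPf xx0) (negPf (notC _ x0O)).
rewrite negbK in dAO.
have -> : b.+1%:R * b.+1%:R^-1 ^+ #|A :\: C|
          = \sum_(x in O) b.+1%:R^-1 ^+ #|A :\: C| :> R.
  by rewrite sumr_const cO mulr_natl.
apply: ler_sum => x xO.
case: ifP => _; last exact: exprn_ge0.
rewrite (_ : A :\: (x |: C) = A :\: C) //.
apply/setP => y; rewrite !inE negb_or; case: eqP => //= ->.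
by rewrite (disjointFl dAO xO) andbF.
Qed.

Lemma potential_offer F C O :
  [disjoint F & C] -> O \subset F -> #|O| = b.+1 ->
  exists2 x, x \in O & potential (F :\: O) (x |: C) <= potential F C.
Proof.
(* Averaging by contradiction: were every choice to raise the potential, the sum over [O] would rise
   too, against [le]. *)
move=> dFC OF cO; apply/exists_inP; apply: contraT => /exists_inPn no.
have le : \sum_(x in O) potential (F :\: O) (x |: C)
          <= \sum_(x in O) potential F C.
  rewrite sumr_const cO -mulr_natl /potential mulr_sumr.
  under eq_bigr do rewrite big_mkcondr.
  rewrite exchange_big /= [leRHS]big_mkcondr /=; apply: ler_sum => A AFam.
  case: ifPn => AFC; first exact: potential_weight_offer.
  rewrite big1 // => x xO; case: ifPn => // sA; case/negP: AFC.
  apply: subset_trans sA _; apply/subsetP => y; rewrite !inE.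
  case/orP=> [/andP[_ ->]//|/orP[/eqP->|->]]; last by rewrite orbT.
  by rewrite (subsetP OF).
suff lt : \sum_(x in O) potential F C
          < \sum_(x in O) potential (F :\: O) (x |: C).
  by have := lt_le_trans lt le; rewrite ltxx.
have [x xO] : exists x, x \in O by apply/card_gt0P; rewrite cO.
rewrite !(big_setD1 x xO) /= ltr_leD //; first by rewrite ltNge no.
by apply: ler_sum => y /setD1P[_ yO]; rewrite ltW // ltNge no.
Qed.

Lemma wins_le_potential F C :
  #|[set A in Fam | A \subset C]|%:R <= potential F C.
Proof.
rewrite /potential -sum1_card natr_sum big_mkcond [leRHS]big_mkcond /=.
apply: ler_sum => A _; rewrite inE.
have q_ge0 : 0 <= b.+1%:R^-1 :> R by rewrite invr_ge0 ler0n.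
case: ifP => [/andP[-> sAC]|_]; last by case: ifP => // _; rewrite exprn_ge0.
rewrite (subset_trans sAC (subsetUr _ _)) /=.
by move: sAC; rewrite -setD_eq0 => /eqP ->; rewrite cards0 expr0.
Qed.

Lemma wc_value_from_le_potential fuel F C :
  [disjoint F & C] -> (wc_value_from Fam b fuel F C)%:R <= potential F C.
Proof.
elim: fuel F C => [|fuel IH] F C dFC /=; first exact: wins_le_potential.
case: ifP => _; first exact: wins_le_potential.
elim/big_ind: _ => [|v w vP wP|O /andP[OF /eqP cO]].
(* An empty maximum is 0, and the potential is nonnegative since it bounds a cardinality. *)
- exact: le_trans (wins_le_potential F C).
- by rewrite /maxn; case: ifP.
have [x xO] := potential_offer dFC OF cO; apply: le_trans.
apply: le_trans (IH _ _ _).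
  by rewrite ler_nat; apply: bigminn_le.
apply/pred0P => y /=; rewrite !inE; case: eqP => [->|_] /=; first by rewrite xO.
by case yF: (y \in F); rewrite ?andbF // (disjointFr dFC yF) andbF.
Qed.

Lemma wc_value_le (L : nat) (board : {set X}) :
  (forall A, A \in Fam -> (L <= #|A|)%N) ->
  (wc_value Fam b board)%:R <= #|Fam|%:R * b.+1%:R^-1 ^+ L :> R.
Proof.
move=> cA; apply: le_trans (wc_value_from_le_potential _ _) _.
  by rewrite -setI_eq0 setI0.
have q_ge0 : 0 <= b.+1%:R^-1 :> R by rewrite invr_ge0 ler0n.
have -> : #|Fam|%:R * b.+1%:R^-1 ^+ L = \sum_(A in Fam) b.+1%:R^-1 ^+ L :> R.
  by rewrite sumr_const mulr_natl.
rewrite /potential big_mkcondr /=.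
apply: ler_sum => A AFam; case: ifP => _; last exact: exprn_ge0.
rewrite setD0; apply: ler_wiXn2l; rewrite ?cA //.
by rewrite invf_le1 ?ler1n ?ltr0n.
Qed.

End Potential.

(** * Growing a tree vertex by vertex *)

Section Tree.

Variables (V : finType) (e : rel V).
Hypothesis tree_e : is_tree e.

Definition induced (S : {set V}) : rel V :=
  [rel x y | [&& x \in S, y \in S & e x y]].

Definition connected_in (S : {set V}) :=
  forall x y, x \in S -> y \in S -> connect (induced S) x y.

Lemma exists_boundary_edge (S : {set V}) :
  S != set0 -> S != setT -> exists p v, [/\ p \in S, v \notin S & e p v].
Proof.
case: tree_e => _ _ con _ /set0Pn[r rS] ST.
have [v vS] : exists v, v \notin S.
  apply/existsP; apply: contraNT ST => /existsPn al; apply/eqP/setP => x.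
  by rewrite inE; move: (al x); rewrite negbK.
have /connectP[s] := con r v; elim: s r rS => [|y s IH] x xS /=.
  by move=> _ vx; rewrite vx xS in vS.
case/andP=> exy py lst; have [yS|yS] := boolP (y \in S).
  exact: IH yS py lst.
by exists x, y.
Qed.

(** Two neighbours of [v] in [S] are joined by a path inside [S], which closes through [v] to a
    cycle; its length exceeds 2 unless the two coincide. *)
Lemma unique_boundary_edge (S : {set V}) (p x v : V) :
  connected_in S -> p \in S -> x \in S -> v \notin S -> e p v -> e x v -> x = p.
Proof.
case: tree_e => [[sym_e _]] _ _ acyc con pS xS vS epv exv.
apply/eqP; apply: contraT => xp.
have /connectP[s0 path0 last0] := con _ _ xS pS.
case/shortenP: path0 last0 => s ps us _ lst.
have sS : {subset s <= S}.
  elim: s x {xS exv xp us lst} ps => [//|y s IH] x /= /andP[/and3P[_ yS _] /IH sub].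
  by move=> z; rewrite inE => /orP[/eqP -> //|/sub].
have es : path e x s by apply: sub_path ps => y z /and3P[].
have : size (v :: x :: s) <= 2.
  apply: acyc; rewrite /ucycle /= rcons_path es -lst epv (sym_e v) exv /=.
  have vs : v \notin s by apply: contra vS => /sS.
  have vx : v != x by apply: contraNneq vS => ->.
  by rewrite inE negb_or vx vs.
case: s lst {ps us es sS} => [/= px|//]; by rewrite px eqxx in xp.
Qed.

Lemma connected_in_add (S : {set V}) (p v : V) :
  connected_in S -> p \in S -> e p v -> connected_in (v |: S).
Proof.
case: tree_e => [[sym_e _]] _ _ _ con pS epv.
have sub x y : connect (induced S) x y -> connect (induced (v |: S)) x y.
  apply: connect_sub => {}x {}y /and3P[xS yS exy]; apply: connect1.
  by rewrite /induced /= !inE xS yS exy !orbT.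
have pv : connect (induced (v |: S)) p v.
  by apply: connect1; rewrite /induced /= !inE pS eqxx epv orbT.
have vp : connect (induced (v |: S)) v p.
  by apply: connect1; rewrite /induced /= !inE pS eqxx sym_e epv orbT.
move=> x y /setU1P[->|xS] /setU1P[->|yS]; first exact: connect0.
- exact: connect_trans vp (sub _ _ (con _ _ pS yS)).
- exact: connect_trans (sub _ _ (con _ _ xS pS)) pv.
- exact/sub/con.
Qed.

(** The set built so far is kept connected inside the proof; this is what makes the earlier
    neighbour of each new vertex unique. *)
Lemma tree_ind (P : {set V} -> Prop) :
  (forall r, P [set r]) ->
  (forall (S : {set V}) p v, p \in S -> v \notin S -> e p v ->
     (forall x, x \in S -> e x v -> x = p) -> P S -> P (v |: S)) ->
  P setT.
Proof.
move=> P1 PU.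
suff grow k : k < #|V| -> exists S : {set V}, [/\ #|S| = k.+1, connected_in S & P S].
  have V0 : 0 < #|V| by case: tree_e.
  have [|S [cS _ PS]] := grow #|V|.-1; first by rewrite ltn_predL.
  have <- // : S = setT.
  by apply/eqP; rewrite eqEcard subsetT cardsT cS prednK ?leqnn.
elim: k => [/card_gt0P[r _]|k IH ltk].
  exists [set r]; split; rewrite ?cards1 // => x y /set1P-> /set1P->.
  exact: connect0.
have [S [cS conS PS]] := IH (ltnW ltk).
have [||p [v [pS vS epv]]] := @exists_boundary_edge S.
- by rewrite -card_gt0 cS.
- by apply: contraTneq ltk => ST; rewrite -cS ST cardsT ltnn.
exists (v |: S); split; first by rewrite cardsU1 vS cS.
  exact: connected_in_add conS pS epv.
apply: (PU _ _ _ pS vS epv _ PS) => x xS exv.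
exact: unique_boundary_edge conS pS xS vS epv exv.
Qed.

(** Each vertex [v] added by [tree_ind] contributes a new edge, as [f v] lies on no earlier one. *)
Lemma card_copy_edges (n : nat) (f : {ffun V -> 'I_n}) :
  injective f -> #|V|.-1 <= #|copy_edges e f|.
Proof.
move=> f_inj.
pose cS (S : {set V}) := [set [set f xy.1; f xy.2]
  | xy in [set xy : V * V | [&& xy.1 \in S, xy.2 \in S & e xy.1 xy.2]]].
have /subset_leq_card : cS setT \subset copy_edges e f.
  apply/subsetP => A /imsetP[xy]; rewrite inE => /and3P[_ _ exy] ->.
  by apply/imsetP; exists xy; rewrite ?inE.
apply: leq_trans; rewrite -cardsT.
apply: (@tree_ind (fun S => #|S|.-1 <= #|cS S|)) => [r|S p v pS vS epv _ IH].
  by rewrite cards1.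
have cSU : [set f p; f v] |: cS S \subset cS (v |: S).
  apply/subsetP => A /setU1P[->|/imsetP[[x y]]].
    by apply/imsetP; exists (p, v); rewrite // !inE /= pS eqxx epv orbT.
  rewrite inE /= => /and3P[xS yS exy] ->.
  by apply/imsetP; exists (x, y); rewrite // !inE /= xS yS exy !orbT.
apply: leq_trans (subset_leq_card cSU); rewrite !cardsU1 vS /=.
suff -> : [set f p; f v] \notin cS S by move: IH; case: #|S|.
apply: contra vS => /imsetP[[x y]]; rewrite inE /= => /and3P[xS yS _].
move=> /setP/(_ (f v)); rewrite !inE eqxx orbT => /esym/orP[]/eqP/f_inj-> //.
Qed.

End Tree.

(** * Block-respecting copies *)

Lemma exists_inj_ord (T : finType) (n : nat) :
  #|T| <= n -> exists f : T -> 'I_n, injective f.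
Proof.
move=> le; exists (widen_ord le \o enum_rank) => x y /(congr1 val) /=.
by move/val_inj/enum_rank_inj.
Qed.

Section Blocks.

Variables (V : finType) (e : rel V) (n m b : nat) (phi : V * 'I_m -> 'I_n).
Hypotheses (e_sym : symmetric e) (e_irr : irreflexive e).
Hypothesis phi_inj : injective phi.

Implicit Types (S : {set V}) (F C : {set {set 'I_n}}).
Implicit Types (h : {ffun V -> 'I_m}) (H : {set {ffun V -> 'I_m}}).

(** [phi (x, a)] is vertex [a] of the block of [x]; blocks are disjoint since [phi] is injective. A
    copy is stored as a map [h] choosing one vertex in each block. *)
Definition block_edge (x : V) (a : 'I_m) (y : V) (c : 'I_m) : {set 'I_n} :=
  [set phi (x, a); phi (y, c)].

Lemma block_edge_sym x a y c : block_edge x a y c = block_edge y c x a.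
Proof. exact: setUC. Qed.

Lemma mem_block_edge x a y c z d :
  (phi (z, d) \in block_edge x a y c) = ((z, d) == (x, a)) || ((z, d) == (y, c)).
Proof. by rewrite !inE !(inj_eq phi_inj). Qed.

Lemma block_edge_inj x y a c a' c' : x != y ->
  block_edge x a y c = block_edge x a' y c' -> a = a' /\ c = c'.
Proof.
move=> xy E; have := mem_block_edge x a' y c' x a.
have := mem_block_edge x a' y c' y c; rewrite -E !mem_block_edge !eqxx orbT.
rewrite !xpair_eqE !eqxx [y == x]eq_sym (negPf xy) /= orbF.
by move=> /esym/eqP -> /esym/eqP ->.
Qed.

Lemma block_edge_blocks x y a c p v a' c' :
  block_edge x a y c = block_edge p a' v c' -> (y == p) || (y == v).
Proof.
move=> E; have := mem_block_edge p a' v c' y c.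
rewrite -E mem_block_edge eqxx orbT !xpair_eqE => /esym/orP[]/andP[-> _] //.
by rewrite orbT.
Qed.

(** Joining [v] to [S] only uses edges between blocks of [v |: S], so this invariant survives each
    stage. *)
Definition edges_free_outside S F := forall x y a c,
  x != y -> y \notin S -> block_edge x a y c \in F.

(** [h] is total, but its values outside [S] are placeholders until the tree grows there. *)
Definition realized S C h :=
  {in S &, forall x y, e x y -> block_edge x (h x) y (h y) \in C}.

Definition extend h (v : V) (c : 'I_m) : {ffun V -> 'I_m} :=
  [ffun u => if u == v then c else h u].

Lemma realized_extend S C C' h p v c :
  p \in S -> v \notin S -> {in S, forall x, e x v -> x = p} ->
  C \subset C' -> realized S C h -> block_edge p (h p) v c \in C' ->
  realized (v |: S) C' (extend h v c).
Proof.
move=> pS vS uniq_p CC hC pvC.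
have ne x : x \in S -> (x == v) = false by apply: contraTF => /eqP->.
move=> x y /setU1P[->|xS] /setU1P[->|yS]; rewrite !ffunE ?eqxx ?ne //.
- by rewrite e_irr.
- by rewrite e_sym => /(uniq_p _ yS) ->; rewrite block_edge_sym.
- by move/(uniq_p _ xS) ->.
- by move=> exy; apply: (subsetP CC); apply: hC.
Qed.

(** * Dense regime: multiplying copies by disjoint stars *)

(** The block of [v] contains [d] disjoint groups of b + 1 vertices. For each [a] and [j], Waiter
    offers the edges from [a] to group [j]; the picks [c a j] differ for different [j] because the
    groups are disjoint. *)
Lemma forces_stars S F C p v d :
  p \in S -> v \notin S -> d * b.+1 <= m -> edges_free_outside S F ->
  forces b (fun F' C' => [/\ edges_free_outside (v |: S) F', C \subset C'
    & exists c : 'I_m -> 'I_d -> 'I_m, (forall a, injective (c a)) /\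
        forall a j, block_edge p a v (c a j) \in C']) F C.
Proof.
move=> pS vS dm freeF.
have pv : p != v by apply: contraNneq vS => <-.
have [slot slot_inj] : exists f : 'I_d * 'I_b.+1 -> 'I_m, injective f.
  by apply: exists_inj_ord; rewrite card_prod !card_ord.
pose O (aj : 'I_m * 'I_d) :=
  [set block_edge p aj.1 v (slot (aj.2, i)) | i : 'I_b.+1].
apply: forces_weaken (@forces_family _ b _ O (enum {: 'I_m * 'I_d}) F C _ _ _ _).
- move=> F' C' [CC FF hit]; split=> // [x y a c xy|].
    rewrite in_setU1 negb_or => /andP[yv yS].
    apply: FF => [|aj _]; first exact: freeF.
    apply/imsetP => -[i _ /block_edge_blocks]; rewrite (negPf yv) orbF => /eqP yp.
    by rewrite yp pS in yS.
  have [|i iC] := @fin_all_exists _ _ (fun (aj : 'I_m * 'I_d) (i : 'I_b.+1) =>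
      block_edge p aj.1 v (slot (aj.2, i)) \in C').
    move=> aj; have [|z /imsetP[i _ ->] iC] := hit aj; first by rewrite mem_enum.
    by exists i.
  exists (fun a j => slot (j, i (a, j))); split=> [a j j' /slot_inj[]//|a j].
  exact: iC (a, j).
- exact: enum_uniq.
- by move=> aj _; apply/subsetP => z /imsetP[i _ ->]; apply: freeF.
- move=> aj _; rewrite card_imset ?card_ord // => i i'.
  by case/(block_edge_inj pv) => _ /slot_inj[].
- move=> [a j] [a' j'] _ _; apply: contraR => /pred0Pn[z /andP[/=]].
  case/imsetP => i _ -> /imsetP[i' _] /(block_edge_inj pv)/= [-> /slot_inj[-> _]].
  exact: eqxx.
Qed.

Definition dense_state d S F C := edges_free_outside S F /\
  exists H, [/\ {in H, forall h, realized S C h},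
    {in H &, forall h h', {in S, h =1 h'} -> h = h'}
    & #|H| = m * d ^ #|S|.-1].

(** Each copy is extended by the picks in the [d] stars centred at its vertex in the block of [p].
    An extension determines [h] by its values on [S], and then the star by its value at [v]. *)
Lemma forces_dense_state S F C p v d :
  p \in S -> v \notin S -> {in S, forall x, e x v -> x = p} ->
  d * b.+1 <= m -> dense_state d S F C ->
  forces b (dense_state d (v |: S)) F C.
Proof.
move=> pS vS uniq_p dm [freeF [H [HC H_inj cH]]].
apply: forces_weaken (forces_stars C pS vS dm freeF).
move=> F' C' [freeF' CC [c [c_inj cC]]]; split=> //.
pose ext (hj : {ffun V -> 'I_m} * 'I_d) := extend hj.1 v (c (hj.1 p) hj.2).
have ext_inj : {in setX H setT &, forall hj hj',
    {in v |: S, ext hj =1 ext hj'} -> hj = hj'}.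
  move=> [h j] [h' j'] /setXP[hH _] /setXP[hH' _] /= E.
  have hh : h = h'.
    apply: H_inj => // x xS; have := E x; rewrite !ffunE in_setU1 xS orbT.
    by case: eqP xS vS => [->->//|_ _ _ ->].
  have := E v; rewrite !ffunE setU11 eqxx hh => /(_ isT)/c_inj /= <- //.
exists (ext @: setX H setT); split.
- move=> _ /imsetP[[h j] /setXP[hH _] ->].
  exact: realized_extend CC (HC h hH) (cC _ _).
- move=> _ _ /imsetP[hj hjH ->] /imsetP[hj' hjH' ->] /ext_inj E.
  by rewrite E.
- rewrite card_in_imset => [|hj hj' hjH hjH' E]; last first.
    by apply: ext_inj => // x _; rewrite E.
  rewrite cardsX cardsT card_ord cH cardsU1 vS -mulnA -expnSr; congr (_ * _ ^ _).
  by rewrite add1n prednK // card_gt0; apply/set0Pn; exists p.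
Qed.

(** * Sparse regime: extending vertex-disjoint copies by a matching *)

Definition sparse_state g S F C := edges_free_outside S F /\
  exists H, [/\ {in H, forall h, realized S C h},
    {in S, forall x, {in H &, forall h h', h x = h' x -> h = h'}}
    & #|H| = m %/ g ^ #|S|.-1].

(* After [t] rounds the copies in [K] have been extended, by pairwise distinct
   vertices of the block of [v], and those in [D] are still untouched. *)
Definition matching_state g H p v t F C :=
  exists (D K : {set {ffun V -> 'I_m}}) (w : {ffun V -> 'I_m} -> 'I_m),
  [/\ D \subset H, K \subset H, [disjoint D & K],
      (#|D| = #|H| - t * g) /\ (#|K| = t)
    & [/\ {in K &, injective w},
          {in K, forall h, block_edge p (h p) v (w h) \in C}
        & {in D, forall h c, block_edge p (h p) v c \in F}]].

Lemma matching_state_step g H p v t F C :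
  p != v -> {in H &, forall h h', h p = h' p -> h = h'} ->
  1 < g -> b.+1.*2 <= g * m -> t < #|H| %/ g ->
  matching_state g H p v t F C ->
  exists O : {set {set 'I_n}}, [/\ O \subset F, #|O| = b.+1,
    {in O, forall z, exists a c, z = block_edge p a v c}
    & {in O, forall z, matching_state g H p v t.+1 (F :\: O) (z |: C)}].
Proof.
move=> pv H_inj g1 bg ltT [D [K [w [DH KH dDK [cD cK] [w_inj wC DF]]]]].
have g0 : 0 < g by apply: ltnW.
have ltgH : t.+1 * g <= #|H| by rewrite -leq_divRL.
have cHm : #|H| <= m.
  have /card_in_imset <- := H_inj.
  by apply: leq_trans (max_card _) _; rewrite card_ord.
have [D0 D0D cD0] : exists2 D0 : {set {ffun V -> 'I_m}}, D0 \subset D & #|D0| = g.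
  apply: exists_subset_card.
  by rewrite cD leq_subRL ?(leq_trans _ ltgH) ?leq_mul // addnC -mulSn.
pose U := ~: (w @: K).
have cU : m - t <= #|U|.
  by rewrite cardsCs setCK card_ord leq_sub2l // -cK leq_imset_card.
have [|B BD0U cB] := @exists_subset_card _ (setX D0 U) b.+1.
  rewrite cardsX cD0.
  have tm : t.*2 <= m.
    rewrite -muln2 (leq_trans _ cHm) // (leq_trans _ ltgH) // mulSn.
    by rewrite (leq_trans _ (leq_addl _ _)) // leq_mul.
  apply: leq_trans (leq_mul (leqnn g) cU); nia.
have D0H : D0 \subset H by apply: subset_trans DH.
pose O := [set block_edge p (hc.1 p) v hc.2
  | hc : {ffun V -> 'I_m} * 'I_m in B].
have BP hc : hc \in B -> hc.1 \in D0 /\ hc.2 \notin w @: K.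
  by move=> /(subsetP BD0U); rewrite !inE => /andP[].
exists O; split.
- apply/subsetP => _ /imsetP[hc /BP[hD0 _] ->]; apply: DF.
  exact: (subsetP D0D).
- rewrite card_in_imset // => -[h c] [h' c'] /BP[/= /(subsetP D0H) hH _].
  move=> /BP[/= /(subsetP D0H) hH' _] /(block_edge_inj pv)[E ->].
  by rewrite (H_inj _ _ hH hH' E).
- by move=> _ /imsetP[hc _ ->]; exists (hc.1 p), hc.2.
move=> _ /imsetP[[h c] /BP[/= hD0 cK'] ->].
have hD := subsetP D0D _ hD0; have hK : h \notin K by rewrite (disjointFr dDK hD).
have neK h' : h' \in K -> (h' == h) = false by apply: contraTF => /eqP ->.
exists (D :\: D0), (h |: K), (fun h' => if h' == h then c else w h').
split; last split.
- exact: subset_trans (subsetDl _ _) DH.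
- by rewrite subUset KH sub1set (subsetP DH).
- apply/pred0P => h' /=; rewrite !inE; case: eqP => [->|_] /=; first by rewrite hD0.
  by case h'D: (h' \in D); rewrite ?andbF // (disjointFr dDK h'D) andbF.
- split; last by rewrite cardsU1 hK cK.
  by rewrite cardsD (setIidPr D0D) cD cD0 mulSn addnC subnDA.
- move=> h1 h2 /setU1P[->|h1K] /setU1P[->|h2K]; rewrite ?eqxx ?neK //.
  + by move=> cw; rewrite cw imset_f in cK'.
  + by move=> cw; rewrite -cw imset_f in cK'.
  + exact: w_inj.
- move=> h' /setU1P[->|h'K]; first by rewrite eqxx setU11.
  by rewrite neK // inE wC ?orbT.
- move=> h' /setDP[h'D h'D0] c'; rewrite inE DF // andbT.
  apply: contra h'D0 => /imsetP[[h1 c1] /BP[/= h1D0 _]].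
  case/(block_edge_inj pv) => E _.
  by rewrite (H_inj _ _ _ _ E) ?(subsetP DH) // (subsetP D0D).
Qed.

(** The matching takes [#|H| %/ g] rounds. Nested integer divisions combine, (m / g^i) / g = m /
    g^(i+1), so rounding does not accumulate. *)
Lemma forces_sparse_state S F C p v g :
  p \in S -> v \notin S -> {in S, forall x, e x v -> x = p} ->
  1 < g -> b.+1.*2 <= g * m -> sparse_state g S F C ->
  forces b (sparse_state g (v |: S)) F C.
Proof.
move=> pS vS uniq_p g1 bg [freeF [H [HC H_inj cH]]].
have pv : p != v by apply: contraNneq vS => <-.
pose P t F' C' := [/\ edges_free_outside (v |: S) F', C \subset C'
  & matching_state g H p v t F' C'].
apply: (forces_weaken _ (@forces_iter _ b P (#|H| %/ g) F C _ _)).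
- move=> F' C' [freeF' CC [D [K [w [_ KH _ [_ cK] [w_inj wC _]]]]]]; split=> //.
  exists [set extend h v (w h) | h in K].
  have ext_inj x : x \in S -> {in K &, forall h h',
      extend h v (w h) x = extend h' v (w h') x -> h = h'}.
    move=> xS h h' hK hK'; have xv : (x == v) = false.
      by apply: contraTF xS => /eqP->.
    by rewrite !ffunE xv; apply: H_inj; rewrite // (subsetP KH).
  split.
  + move=> _ /imsetP[h hK ->].
    by apply: realized_extend CC (HC h _) (wC h hK); rewrite ?(subsetP KH).
  + move=> x xvS _ _ /imsetP[h hK ->] /imsetP[h' hK' ->] E.
    suff -> : h = h' by [].
    case/setU1P: xvS E => [->|xS]; last exact: ext_inj.
    by rewrite !ffunE eqxx; apply: w_inj.
  + rewrite card_in_imset => [|h h' hK hK' E]; last first.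
      by apply: (ext_inj p) => //; rewrite E.
    rewrite cK cH -divnMA -expnSr cardsU1 vS; congr (_ %/ _ ^ _).
    by rewrite add1n prednK // card_gt0; apply/set0Pn; exists p.
- move=> t F' C' ltT [freeF' CC mt].
  have [O [OF cO Oe stepO]] := matching_state_step pv (H_inj p pS) g1 bg ltT mt.
  exists O; split=> // z zO; split; last exact: stepO.
    move=> x y a c xy yS; rewrite inE freeF' // andbT; apply: contra yS.
    case/Oe => a' [c' /block_edge_blocks/orP[]/eqP->]; last exact: setU11.
    by rewrite inE pS orbT.
  exact: subset_trans CC (subsetUr _ _).
- split=> //.
    by move=> x y a c xy; rewrite in_setU1 negb_or => /andP[_]; apply: freeF.
  (* No copy is extended yet; [h p] merely supplies an element of ['I_m]. *)
  exists H, set0, (fun h => h p); split=> //; rewrite ?sub0set //.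
  + by rewrite -setI_eq0 setI0.
  + by rewrite mul0n subn0 cards0.
  split=> [h h'|h|h hH c]; rewrite ?inE //.
  exact: freeF.
Qed.

(** * Initial copies and counting of edge sets *)

Lemma edges_free_outside_complete S : edges_free_outside S (complete_edges n).
Proof.
move=> x y a c xy _; rewrite inE cards2 (inj_eq phi_inj) xpair_eqE.
by rewrite (negPf xy).
Qed.

(** One-vertex copies: distinct constant maps differ at every vertex, so they start either strategy
    from any root. *)
Let constants : {set {ffun V -> 'I_m}} := [set [ffun=> a] | a : 'I_m].


Lemma card_constants (r : V) : #|constants| = m.
Proof.
by rewrite card_imset ?card_ord // => a c /ffunP/(_ r); rewrite !ffunE.
Qed.

Lemma constants_inj (r : V) :
  {in constants &, forall h h', h r = h' r -> h = h'}.
Proof. by move=> _ _ /imsetP[a _ ->] /imsetP[c _ ->]; rewrite !ffunE => ->. Qed.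

Lemma realized_set1 r C h : realized [set r] C h.
Proof. by move=> x y /set1P-> /set1P->; rewrite e_irr. Qed.

Lemma dense_state_set1 d r : dense_state d [set r] (complete_edges n) set0.
Proof.
split; first exact: edges_free_outside_complete.
exists constants; split; first by move=> h _; apply: realized_set1.
  by move=> h h' hc hc' E; apply: constants_inj (E _ (set11 r)).
by rewrite (card_constants r) cards1 muln1.
Qed.

Lemma sparse_state_set1 g r : sparse_state g [set r] (complete_edges n) set0.
Proof.
split; first exact: edges_free_outside_complete.
exists constants; split; first by move=> h _; apply: realized_set1.
  by move=> x _; apply: constants_inj.
by rewrite (card_constants r) cards1 divn1.
Qed.

(** Distinct maps give distinct edge sets: an edge at [x], provided by [nbr], reveals the vertex
    chosen in the block of [x], since a copy meets each block only once. *)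
Lemma card_realized_le_copies C H :
  (forall x, exists y, e x y) -> {in H, forall h, realized setT C h} ->
  #|H| <= #|[set A in copies e n | A \subset C]|.
Proof.
move=> nbr HC.
pose emb h : {ffun V -> 'I_n} := [ffun x => phi (x, h x)].
rewrite -(card_in_imset (f := fun h => copy_edges e (emb h)) (D := H)).
  apply/subset_leq_card/subsetP => _ /imsetP[h hH ->]; rewrite inE.
  apply/andP; split.
    apply/imsetP; exists (emb h) => //; rewrite inE; apply/injectiveP => x y.
    by rewrite !ffunE => /phi_inj[].
  apply/subsetP => A /imsetP[[x y]]; rewrite inE /= => exy ->; rewrite !ffunE.
  by apply: HC; rewrite ?inE.
move=> h h' _ _ /= E; apply/ffunP => x; have [y exy] := nbr x.
have : [set emb h x; emb h y] \in copy_edges e (emb h').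
  by rewrite -E; apply/imsetP; exists (x, y); rewrite ?inE.
case/imsetP => -[x' y'] _ /= /setP/(_ (phi (x, h x))); rewrite !ffunE.
rewrite mem_block_edge eqxx /= mem_block_edge !xpair_eqE.
by case/esym/orP=> /andP[/eqP -> /eqP].
Qed.

End Blocks.

(** * The value of the tree game *)

Lemma leq_double_trunc_div d x : 0 < d -> d <= x -> x <= 2 * (x %/ d) * d.
Proof.
move=> d_gt0 dx; have := ltn_ceil x d_gt0; rewrite mulSn -mulnA.
have : d <= x %/ d * d by rewrite leq_pmull // divn_gt0.
by move: (x %/ d * d) => y; lia.
Qed.

Section TreeValue.

Variables (V : finType) (e : rel V) (n b : nat).
Hypotheses (tree_e : is_tree e) (V_gt1 : 1 < #|V|).

Lemma tree_has_neighbor x : exists y, e x y.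
Proof.
case: (tree_e) => -[e_sym _] _ _ _.
have [||p [v [/set1P-> _ epv]]] := exists_boundary_edge tree_e (S := [set x]).
- by apply/set0Pn; exists x; rewrite set11.
- by apply: contraTneq V_gt1 => E; rewrite -cardsT -E cards1.
by exists v.
Qed.

(** The frame shared by both regimes: [tree_ind] chains the stages of Waiter's strategy into one. *)
Lemma S_value_ge_state m (phi : V * 'I_m -> 'I_n) (N : nat)
    (state : {set V} -> {set {set 'I_n}} -> {set {set 'I_n}} -> Prop) :
  injective phi ->
  (forall r, state [set r] (complete_edges n) set0) ->
  (forall (S : {set V}) F C p v, p \in S -> v \notin S ->
     {in S, forall x, e x v -> x = p} -> state S F C ->
     forces b (state (v |: S)) F C) ->
  (forall F C, state setT F C -> exists2 H : {set {ffun V -> 'I_m}},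
     {in H, forall h, realized e phi setT C h} & N <= #|H|) ->
  N <= S_value e n b.
Proof.
move=> phi_inj st1 stU stT.
have fT : forces b (state setT) (complete_edges n) set0.
  apply: (@tree_ind _ _ tree_e
    (fun S => forces b (state S) (complete_edges n) set0)) => [r|S p v pS vS _ u].
    exact/forces_done/st1.
  by apply: forces_trans => F C; apply: stU pS vS u.
apply: forces_wc_value_from_ge fT => // F C /stT[H HC le].
exact/(leq_trans le)/(card_realized_le_copies phi_inj tree_has_neighbor HC).
Qed.

Lemma S_value_ge_dense m d :
  #|V| * m <= n -> d * b.+1 <= m -> m * d ^ #|V|.-1 <= S_value e n b.
Proof.
case: (tree_e) => -[e_sym e_irr] _ _ _ kmn dbm.
have [phi phi_inj] : exists f : V * 'I_m -> 'I_n, injective f.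
  by apply: exists_inj_ord; rewrite card_prod card_ord.
apply: (S_value_ge_state phi_inj (state := dense_state e phi d)).
- exact: dense_state_set1.
- by move=> S F C p v pS vS u st; apply: forces_dense_state u dbm st.
- by move=> F C [_ [H [HC _ cH]]]; exists H; rewrite // cH cardsT.
Qed.

Lemma S_value_ge_sparse m g :
  #|V| * m <= n -> 1 < g -> b.+1.*2 <= g * m ->
  m %/ g ^ #|V|.-1 <= S_value e n b.
Proof.
case: (tree_e) => -[e_sym e_irr] _ _ _ kmn g1 bg.
have [phi phi_inj] : exists f : V * 'I_m -> 'I_n, injective f.
  by apply: exists_inj_ord; rewrite card_prod card_ord.
apply: (S_value_ge_state phi_inj (state := sparse_state e phi g)).
- exact: sparse_state_set1.
- by move=> S F C p v pS vS u st; apply: forces_sparse_state u g1 bg st.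
- by move=> F C [_ [H [HC _ cH]]]; exists H; rewrite // cH cardsT.
Qed.

(** The bound on b enters as an inequality between natural powers, which avoids real exponents. *)
Lemma S_value_ge k : #|V| = k -> 0 < b ->
  b ^ k.-1 * (12 * k) ^ k <= n ^ k ->
  n ^ k <= (6 * k) ^ k * b.+1 ^ k.-1 * S_value e n b.
Proof.
move=> cV b_gt0; have k_gt1 : 1 < k by rewrite -cV.
have k_gt0 : 0 < k by apply: ltnW.
have kE (x : nat) : x ^ k = x * x ^ k.-1 by rewrite -expnS prednK.
move=> bn; pose m := n %/ k.
(* Since b >= 1, the bound on b forces n >= 12k, so the blocks are nonempty. *)
have kn : 12 * k <= n.
  rewrite -(@leq_exp2r _ _ k) //; apply: leq_trans bn.
  by rewrite leq_pmull // expn_gt0 b_gt0.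
have m_gt0 : 0 < m by rewrite divn_gt0 // (leq_trans _ kn) // leq_pmull.
have kmn : #|V| * m <= n by rewrite cV mulnC leq_trunc_div.
have nkm : n <= 2 * k * m.
  rewrite -mulnA (mulnC k) mulnA.
  apply: leq_double_trunc_div => //; apply: leq_trans kn; exact: leq_pmull.
have nkm_k : n ^ k <= (2 * k) ^ k * m ^ k by rewrite -expnMn leq_exp2r.
(* The factor 2k pays for replacing n by [m]; the factor 3 is left for proving [m ^ k <= 3 ^ k *
   b.+1 ^ k.-1 * S_value e n b] in either regime. *)
apply: (leq_trans nkm_k); rewrite (_ : 6 * k = 2 * k * 3); last by lia.
rewrite [(_ * 3) ^ _]expnMn -!mulnA leq_mul2l; apply/orP; right.
have [bm|mb] := leqP b.+1 m.
  pose d := m %/ b.+1.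
  have d_gt0 : 0 < d by rewrite divn_gt0.
  have md : m <= 2 * d * b.+1 by apply: leq_double_trunc_div.
  have le : m * d ^ k.-1 <= S_value e n b.
    by rewrite -cV; apply: S_value_ge_dense => //; apply: leq_trunc_div.
  apply: leq_trans (leq_mul (leqnn _) (leq_mul (leqnn _) le)).
  have : m ^ k.-1 <= 3 ^ k * d ^ k.-1 * b.+1 ^ k.-1.
    apply: (@leq_trans ((2 * d * b.+1) ^ k.-1)).
      by rewrite leq_exp2r // -ltnS prednK.
    rewrite !expnMn !leq_mul2r; apply/orP; right; apply/orP; right.
    apply: (@leq_trans (3 ^ k.-1)); first by rewrite leq_exp2r // -ltnS prednK.
    by rewrite leq_exp2l // leq_pred.
  rewrite [m ^ k]kE => le3; apply: leq_trans (leq_mul (leqnn m) le3) _.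
  by move: (3 ^ k) (d ^ k.-1) (b.+1 ^ k.-1) => x y z; lia.
(* The least g with gm > 2(b + 1); as m < b + 1, also gm <= 3(b + 1). *)
pose g := (b.+1.*2 %/ m).+1.
have gm : b.+1.*2 <= g * m by rewrite ltnW // ltn_ceil.
have g_gt1 : 1 < g by rewrite ltnS divn_gt0 //; lia.
have g3 : g * m <= 3 * b.+1.
  by rewrite mulSn; have := leq_trunc_div b.+1.*2 m; lia.
have k1_gt0 : 0 < k.-1 by rewrite -ltnS prednK.
have le : m %/ g ^ k.-1 <= S_value e n b.
  by rewrite -cV; apply: S_value_ge_sparse.
apply: leq_trans (leq_mul (leqnn _) (leq_mul (leqnn _) le)).
have gm_k : g ^ k.-1 * m ^ k.-1 <= 3 ^ k.-1 * b.+1 ^ k.-1.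
  by rewrite -!expnMn leq_exp2r.
have gk_gt0 : 0 < g ^ k.-1 by rewrite expn_gt0.
(* At least one copy survives: (gm)^(k-1) <= (3(b + 1))^(k-1) <= (6b)^(k-1) <= m^k, the last step
   from (12k)^k b^(k-1) <= n^k <= (2k)^k m^k. *)
have gkm : g ^ k.-1 <= m.
  have mk_gt0 : 0 < m ^ k.-1 by rewrite expn_gt0 m_gt0.
  rewrite -(leq_pmul2r mk_gt0) -kE; apply: (leq_trans gm_k).
  have k2_gt0 : 0 < (2 * k) ^ k by rewrite expn_gt0 muln_gt0 k_gt0.
  rewrite -(leq_pmul2l k2_gt0); apply: leq_trans nkm_k.
  apply: leq_trans bn; rewrite (_ : 12 * k = 2 * k * 6); last by lia.
  rewrite [(_ * 6) ^ _]expnMn [leqRHS]mulnCA leq_mul2l; apply/orP; right.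
  apply: (@leq_trans (b ^ k.-1 * 6 ^ k.-1)).
    by rewrite -!expnMn leq_exp2r //; lia.
  by rewrite leq_mul2l leq_exp2l // leq_pred orbT.
have := leq_double_trunc_div gk_gt0 gkm; move: (m %/ _) => N mN.
rewrite [m ^ k]kE [3 ^ k]kE.
apply: (@leq_trans (2 * N * g ^ k.-1 * m ^ k.-1)); first by rewrite leq_mul2r mN orbT.
rewrite -mulnA; apply: leq_trans (leq_mul (leqnn _) gm_k) _.
by move: (3 ^ k.-1) (b.+1 ^ k.-1) => x y; lia.
Qed.

Lemma S_value_le (R : realFieldType) :
  ((S_value e n b)%:R <= n%:R ^+ #|V| * b.+1%:R^-1 ^+ #|V|.-1 :> R)%R.
Proof.
apply: le_trans (wc_value_le R b (L := #|V|.-1) _ _) _.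
  move=> A /imsetP[f]; rewrite inE => /injectiveP f_inj ->.
  exact: card_copy_edges.
apply: ler_wpM2r; first by rewrite exprn_ge0 // invr_ge0 ler0n.
rewrite -natrX ler_nat; apply: leq_trans (leq_imset_card _ _) _.
by apply: leq_trans (max_card _) _; rewrite card_ffun card_ord.
Qed.

End TreeValue.

(** * Real constants and fractional powers *)

Local Open Scope ring_scope.

Theorem theorem1p5 (R : realType) (k : nat) (hk : (2 <= k)%N) :
  exists c am ap : R,
    [/\ 0 < c, 0 < am, 0 < ap &
      forall (n : nat) (V : finType) (e : rel V) (b : nat),
        (0 < n)%N -> #|V| = k -> is_tree e -> (0 < b)%N ->
        b%:R <= c * (n%:R `^ (k%:R / (k%:R - 1))) ->
        am * n%:R ^+ k * b.+1%:R ^ (1 - k%:Z) <= (S_value e n b)%:R /\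
        (S_value e n b)%:R <= ap * n%:R ^+ k * b.+1%:R ^ (1 - k%:Z)].
Proof.
have k_gt0 : (0 < k)%N by apply: ltnW.
have pos i : (0 < i)%N -> 0 < (i * k)%:R ^+ k :> R.
  by move=> i0; rewrite exprn_gt0 // ltr0n muln_gt0 i0.
(* The first two constants match [S_value_ge]; the upper bound of [S_value_le] has constant 1. *)
exists ((12 * k)%:R ^+ k)^-1, ((6 * k)%:R ^+ k)^-1, 1.
split; rewrite ?invr_gt0 ?pos // => n V e b n0 cV tree_e b0 bc.
have V_gt1 : (1 < #|V|)%N by rewrite cV.
have -> : b.+1%:R ^ (1 - k%:Z) = b.+1%:R^-1 ^+ k.-1 :> R.
  by rewrite exprVn exprnN; congr (_ ^ _); lia.
split; last by rewrite mul1r -cV; apply: S_value_le.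
(* Raising the bound on b to the power k - 1 turns the exponent k/(k - 1) into k, and c^(k-1) <= c
   because c <= 1 and k >= 2. *)
have bn : (b ^ k.-1 * (12 * k) ^ k <= n ^ k)%N.
  rewrite -(ler_nat R) natrM !natrX -ler_pdivlMr ?pos //.
  have k1E : k%:R - 1 = k.-1%:R :> R by rewrite -{1}(prednK k_gt0) -natr1 addrK.
  have k1_neq0 : k.-1%:R != 0 :> R by rewrite pnatr_eq0; lia.
  have : b%:R ^+ k.-1 <= (((12 * k)%:R ^+ k)^-1
           * n%:R `^ (k%:R / (k%:R - 1))) ^+ k.-1 :> R.
    by apply: lerXn2r; rewrite ?nnegrE ?ler0n // (le_trans _ bc) ?ler0n.
  rewrite exprMn -(powR_mulrn k.-1 (powR_ge0 _ _)) -powRrM k1E divfK //.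
  rewrite powR_mulrn ?ler0n // => /le_trans; apply; rewrite mulrC.
  apply: ler_wpM2l; first by rewrite exprn_ge0.
  rewrite -[leRHS]expr1; apply: ler_wiXn2l; last by lia.
    by rewrite invr_ge0 ltW // pos.
  rewrite invf_le1 ?pos // exprn_ege1 // ler1n muln_gt0 //.
have le := S_value_ge tree_e V_gt1 cV b0 bn.
rewrite -(ler_nat R) !natrM !natrX in le.
rewrite exprVn ler_pdivrMr ?exprn_gt0 ?ltr0n // mulrC ler_pdivrMr ?pos //.
by rewrite [leRHS]mulrC [(S_value _ _ _)%:R * _]mulrC mulrA.
Qed.
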